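(* Let $G$ and $\widetilde{G}$ be two group-groupoids, and suppose that $G$ acts on a group $X$ via a group homomorphism $\omega\colon X\rightarrow \operatorname{Ob}(G)$. Let $f=(f_1,f_0)\colon \widetilde{G}\rightarrow G$ be a morphism of group-groupoids. Then $\widetilde{G}$ acts on the pullback group $X{_{\omega}\times_{f_0}}\operatorname{Ob}(\widetilde{G})=\{(x,\widetilde{y})\in X\times \operatorname{Ob}(\widetilde{G}) : \omega(x)=f_0(\widetilde{y})\}$ via the second projection $\pi_2\colon X{_{\omega}\times_{f_0}}\operatorname{Ob}(\widetilde{G})\to\operatorname{Ob}(\widetilde{G})$.
   Context: For a groupoid $G$, $\operatorname{Ob}(G)$ is its set of objects, $G$ also denotes its set of morphisms, $d_0,d_1\colon G\to\operatorname{Ob}(G)$ are the source and target maps, $1_y$ is the identity at $y$, and $h\circ g$ is defined iff $d_0(h)=d_1(g)$. A group-groupoid is an internal groupoid in the category of groups, i.e. a groupoid whose set of morphisms and set of objects are groups (written additively, not necessarily abelian) and whose structure maps (source, target, identities, composition, inversion) are group homomorphisms. A morphism $f=(f_1,f_0)$ of group-groupoids is a functor, with $f_1$ the map on morphisms and $f_0$ the map on objects, such that $f_1$ and $f_0$ are group homomorphisms. An action of a groupoid $G$ on a set $S$ via a function $\omega\colon S\to\operatorname{Ob}(G)$ is a function $\{(g,s)\in G\times S: d_0(g)=\omega(s)\}\to S$, $(g,s)\mapsto g\bullet s$, such that $\omega(g\bullet s)=d_1(g)$, $1_{\omega(s)}\bullet s=s$ and $(h\circ g)\bullet s=h\bullet(g\bullet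 s)$ whenever defined. An action of a group-groupoid $G$ on a group $X$ via $\omega$ consists of a group homomorphism $\omega\colon X\to\operatorname{Ob}(G)$ and an action of the groupoid $G$ on the underlying set of $X$ via $\omega$ such that $(g\bullet x)+(g'\bullet x')=(g+g')\bullet(x+x')$ whenever both sides are defined. *)

(* Defs.v *)
From HB Require Import structures.
From mathcomp Require Import all_boot.

Set Implicit Arguments.
Unset Strict Implicit.
Unset Printing Implicit Defensive.

Local Open Scope group_scope.

(* Groups are MathComp's [groupType]s: possibly infinite and not necessarily
   abelian. Their law is written multiplicatively in the library, so [x * y]
   and [1] stand for the x + y and 0 of the additive notation that is usual
   for group-groupoids. *)
Notation group_hom A B := (UMagmaMorphism.type A B).

Definition pullback_pred (A B C : groupType)
    (f : group_hom A C) (g : group_hom B C) : {pred A * B} :=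
  fun p => f p.1 == g p.2.

Fact pullback_group_closed (A B C : groupType)
  (f : group_hom A C) (g : group_hom B C) : group_closed (pullback_pred f g).
Proof.
split=> [|p q /eqP pP /eqP qP]; apply/eqP; first by rewrite /= !gmulf1.
by rewrite /= !gmulfF pP qP.
Qed.

Record pullback (A B C : groupType)
    (f : group_hom A C) (g : group_hom B C) := Pullback {
  pullback_val :> A * B;
  pullback_valP : pullback_val \in pullback_pred f g
}.

Section PullbackGroup.
Context (A B C : groupType) (f : group_hom A C) (g : group_hom B C).

HB.instance Definition _ := [isSub of pullback f g for @pullback_val A B C f g].
HB.instance Definition _ := [Choice of pullback f g by <:].
HB.instance Definition _ := SubChoice_isSubGroup.Build
  (A * B)%type (pullback_pred f g) (pullback f g) (pullback_group_closed f g).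

Definition pullback_pair (a : A) (b : B) (e : f a = g b) : pullback f g :=
  @Pullback A B C f g (a, b) (introT eqP e).

Definition pullback_snd : group_hom (pullback f g) B :=
  (snd : group_hom (A * B)%type B) \o (val : group_hom (pullback f g) (A * B)%type).

End PullbackGroup.

(* [compose h g e] is the composite h o g, defined when d0 h = d1 g. Objects
   form a [choiceType], so that equality proofs between objects are unique and
   the composite does not depend on [e]. *)
Record groupoid_axioms (Ob Mor : choiceType) (d0 d1 : Mor -> Ob)
    (ident : Ob -> Mor) (compose : forall h g : Mor, d0 h = d1 g -> Mor)
    (inv : Mor -> Mor) : Prop := GroupoidAxioms {
  d0_ident : forall y, d0 (ident y) = y;
  d1_ident : forall y, d1 (ident y) = y;
  d0_comp : forall h g e, d0 (compose h g e) = d0 g;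
  d1_comp : forall h g e, d1 (compose h g e) = d1 h;
  compA : forall k h g (e_hg : d0 h = d1 g) (e_kh : d0 k = d1 h)
      (e_k_hg : d0 k = d1 (compose h g e_hg))
      (e_kh_g : d0 (compose k h e_kh) = d1 g),
    compose k (compose h g e_hg) e_k_hg = compose (compose k h e_kh) g e_kh_g;
  comp_ident_l : forall y g (e : d0 (ident y) = d1 g), compose (ident y) g e = g;
  comp_ident_r : forall g y (e : d0 g = d1 (ident y)), compose g (ident y) e = g;
  d0_inv : forall g, d0 (inv g) = d1 g;
  d1_inv : forall g, d1 (inv g) = d0 g;
  comp_inv_l : forall g (e : d0 (inv g) = d1 g),
    compose (inv g) g e = ident (d0 g);
  comp_inv_r : forall g (e : d0 g = d1 (inv g)),
    compose g (inv g) e = ident (d1 g)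
}.

Record groupoid := Groupoid {
  Ob : choiceType;
  Mor : choiceType;
  d0 : Mor -> Ob;
  d1 : Mor -> Ob;
  ident : Ob -> Mor;
  compose : forall h g : Mor, d0 h = d1 g -> Mor;
  inv_mor : Mor -> Mor;
  groupoidP : groupoid_axioms ident compose inv_mor
}.

Arguments compose {g0} h g e : rename.

Record is_functor (G H : groupoid) (f1 : Mor G -> Mor H) (f0 : Ob G -> Ob H)
    : Prop := IsFunctor {
  functor_d0 : forall g, d0 (f1 g) = f0 (d0 g);
  functor_d1 : forall g, d1 (f1 g) = f0 (d1 g);
  functor_ident : forall y, f1 (ident y) = ident (f0 y);
  functor_comp : forall h g (e : d0 h = d1 g) (e' : d0 (f1 h) = d1 (f1 g)),
    f1 (compose h g e) = compose (f1 h) (f1 g) e'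
}.

(* An internal groupoid in the category of groups: composition is a group
   homomorphism on the pullback group of composable pairs (h, g). *)
Record group_groupoid := GroupGroupoid {
  gOb : groupType;
  gMor : groupType;
  gd0 : group_hom gMor gOb;
  gd1 : group_hom gMor gOb;
  gident : group_hom gOb gMor;
  gcomp : group_hom (pullback gd0 gd1) gMor;
  ginv_mor : group_hom gMor gMor;
  group_groupoidP : @groupoid_axioms gOb gMor gd0 gd1 gident
    (fun h g e => gcomp (pullback_pair e)) ginv_mor
}.

Coercion groupoid_of (G : group_groupoid) : groupoid :=
  Groupoid (group_groupoidP G).

Record group_groupoid_hom (G H : group_groupoid) := GroupGroupoidHom {
  hom1 : group_hom (gMor G) (gMor H);
  hom0 : group_hom (gOb G) (gOb H);
  hom_functor : @is_functor G H hom1 hom0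
}.

Record is_groupoid_action (G : groupoid) (S : Type) (omega : S -> Ob G)
    (act : forall (g : Mor G) (s : S), d0 g = omega s -> S) : Prop :=
  IsGroupoidAction {
  omega_act : forall g s e, omega (act g s e) = d1 g;
  act_ident : forall s (e : d0 (ident (omega s)) = omega s),
    act (ident (omega s)) s e = s;
  act_comp : forall h g s (e_hg : d0 h = d1 g) (e_gs : d0 g = omega s)
      (e_hg_s : d0 (compose h g e_hg) = omega s)
      (e_h_gs : d0 h = omega (act g s e_gs)),
    act (compose h g e_hg) s e_hg_s = act h (act g s e_gs) e_h_gs
}.

Record group_groupoid_action (G : group_groupoid) (X : groupType)
    (omega : group_hom X (gOb G)) := GroupGroupoidAction {
  act : forall (g : gMor G) (x : X), gd0 G g = omega x -> X;
  act_groupoid : @is_groupoid_action G X omega act;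
  act_mul : forall (g g' : gMor G) (x x' : X)
      (e : gd0 G g = omega x) (e' : gd0 G g' = omega x')
      (e'' : gd0 G (g * g') = omega (x * x')),
    act e * act e' = act e''
}.

(* Main.v *)
Require Import Defs.
From mathcomp Require Import all_boot.

Set Implicit Arguments.
Unset Strict Implicit.
Unset Printing Implicit Defensive.

Local Open Scope group_scope.

(** An arrow [g] of the acting group-groupoid is pushed along [f] to [G], where
    it acts on the first coordinate of a point of the pullback, while the second
    coordinate, an object, is carried to the target of [g]:

      [g . (x, y) = (f_1(g) . x, d1 g)].

    This pair is again in the pullback, since [f] is a functor and an action
    sends [x] into the fibre of [omega] over the target:
    [omega (f_1(g) . x) = d1 (f_1(g)) = f_0(d1 g)].  The remaining axioms are
    checked one coordinate at a time.  On the first coordinate each is the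
    same axiom for the given action, once the functor and homomorphism laws of [f_1]
    have moved identities, composites and products through [f_1]; on the second
    each is a law for targets. *)

(** Equalities between objects are unique, so the value of an action depends
    only on the arrow and on the point; this lets one rewrite under the proof of
    composability. *)
Lemma act_congr (G : group_groupoid) (X : groupType)
    (omega : group_hom X (gOb G)) (a : group_groupoid_action omega)
    (g g' : gMor G) (x x' : X)
    (e : gd0 G g = omega x) (e' : gd0 G g' = omega x') :
  g = g' -> x = x' -> act a e = act a e'.
Proof.
by move=> eg ex; subst g' x'; congr (act a); apply: eq_irrelevance.
Qed.

Section PullbackAction.

Context (G Gt : group_groupoid) (X : groupType) (omega : group_hom X (gOb G)).
Context (a : group_groupoid_action omega) (f : group_groupoid_hom Gt G).

Local Notation P := (pullback omega (hom0 f)).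
Local Notation pi2 := (pullback_snd omega (hom0 f)).

Lemma pullback_source (g : gMor Gt) (p : P) :
  gd0 Gt g = pi2 p -> gd0 G (hom1 f g) = omega (val p).1.
Proof.
move=> e; rewrite (eqP (pullback_valP p)).
by rewrite [LHS](functor_d0 (hom_functor f) g) /= e.
Qed.

Lemma pullback_target (g : gMor Gt) (p : P) (e : gd0 Gt g = pi2 p) :
  omega (act a (pullback_source e)) = hom0 f (gd1 Gt g).
Proof.
rewrite [LHS](omega_act (act_groupoid a) (pullback_source e)).
exact: (functor_d1 (hom_functor f) g).
Qed.

Definition pullback_act (g : gMor Gt) (p : P) (e : gd0 Gt g = pi2 p) : P :=
  pullback_pair (pullback_target e).

Lemma pullback_act_groupoid : @is_groupoid_action Gt P pi2 pullback_act.
Proof.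
split=> [g p e | p e | h g p e_hg e_gp e_hg_p e_h_gp] //; apply: val_inj.
- rewrite /= [RHS]surjective_pairing; congr (_, _); last first.
    exact: (d1_ident (group_groupoidP Gt)).
  have e1 : gd0 G (gident G (omega (val p).1)) = omega (val p).1.
    exact: (d0_ident (group_groupoidP G)).
  rewrite -[RHS](act_ident (act_groupoid a) e1); apply: act_congr => //.
  rewrite (eqP (pullback_valP p)).
  exact: (functor_ident (hom_functor f) (val p).2).
- rewrite /=; congr (_, _); last exact: (d1_comp (group_groupoidP Gt)).
  have e1 : @d0 G (hom1 f h) = @d1 G (hom1 f g).
    rewrite (functor_d0 (hom_functor f)) (functor_d1 (hom_functor f)).
    by congr (hom0 f _).
  have e2 : @d0 G (compose (hom1 f h : Mor G) (hom1 f g) e1) = omega (val p).1.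
    rewrite [LHS](d0_comp (group_groupoidP G)).
    exact: (pullback_source e_gp).
  rewrite -[RHS](act_comp (act_groupoid a) (e_hg := e1) e2).
  by apply: act_congr => //; apply: (functor_comp (hom_functor f)).
Qed.

Lemma pullback_act_mul (g g' : gMor Gt) (p p' : P)
    (e : gd0 Gt g = pi2 p) (e' : gd0 Gt g' = pi2 p')
    (e'' : gd0 Gt (g * g') = pi2 (p * p')) :
  pullback_act e * pullback_act e' = pullback_act e''.
Proof.
apply: val_inj => /=; congr (_, _); last by rewrite gmulfM.
have e1 : gd0 G (hom1 f g * hom1 f g') = omega ((val p).1 * (val p').1).
  by rewrite !gmulfM (pullback_source e) (pullback_source e').
rewrite [LHS](act_mul a (pullback_source e) (pullback_source e') e1).
by apply: act_congr => //; rewrite gmulfM.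
Qed.

End PullbackAction.

Theorem proposition3p2 (G Gt : group_groupoid) (X : groupType)
    (omega : group_hom X (gOb G)) (a : group_groupoid_action omega)
    (f : group_groupoid_hom Gt G) :
  inhabited (group_groupoid_action (pullback_snd omega (hom0 f))).
Proof.
split; exact: GroupGroupoidAction (pullback_act_groupoid a f)
  (pullback_act_mul a (f := f)).
Qed.
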